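(* Let $(X,d,\mathfrak m)$ be a doubling metric measure space and let $x,y\in X$. Then the following conditions are quantitatively equivalent: (i) there exist $C>0$, $L\ge1$ such that for every $u\in\mathrm{Lip}(X)$ $$|u(x)-u(y)|\le C\int\mathrm{lip}\,u\,d\mathfrak m^L_{x,y};$$ (ii) there exist $C>0$, $L\ge1$ such that for every $A\subseteq X$ it holds $$\mathscr C\text{-}\mathrm{width}_{x,y}(A)\le C\,\mathfrak m^L_{x,y}(A);$$ (iii) there exist $c>0$, $L\ge1$ such that for every $\Omega\in\mathrm{SS}_{\mathrm{top}}(x,y)$ it holds $(\mathfrak m^L_{x,y})^+(\Omega)\ge c$.
   Context: A metric measure space $(X,d,\mathfrak m)$ is a separable metric space $(X,d)$ (not necessarily complete) with a non-trivial outer measure $\mathfrak m$ which is Radon and finite on bounded sets. It is doubling if there is $C_D\ge1$ with $\mathfrak m(B_{2r}(x))\le C_D\,\mathfrak m(B_r(x))$ for all $x\in X$, $r>0$. ''Quantitatively equivalent'' means that the constants in each property can be chosen depending only on the constants of any other one and on $C_D$. $\mathrm{Lip}(X)$ is the set of Lipschitz functions $X\to\mathbb R$ and $\mathrm{lip}\,u(z):=\lim_{\varepsilon\to0}\sup_{w\in B_\varepsilon(z),\,w\ne z}\frac{|u(w)-u(z)|}{d(z,w)}$ (equal to $0$ at isolated points). For $\varepsilon>0$, $\mathscr C^\varepsilon_{x,y}$ is the set of $\varepsilon$-chains from $x$ to $y$, i.e. finite sequences $c=\{q_i\}_{i=0}^N$ of points of $X$ with $d(q_i,q_{i+1})\le\varepsilon$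 for all $i$, $q_0=x$, $q_N=y$. For $g:X\to[0,+\infty]$, $\int_c g:=\sum_{i=0}^{N-1}\frac{g(q_i)+g(q_{i+1})}{2}d(q_i,q_{i+1})$. The chain width of $A\subseteq X$ is $$\mathscr C\text{-}\mathrm{width}_{x,y}(A):=\lim_{\varepsilon\to0}\inf_{c\in\mathscr C^\varepsilon_{x,y}}\int_c\chi_A,$$ with $\inf\emptyset=+\infty$. $\mathrm{SS}_{\mathrm{top}}(x,y)$ is the family of closed sets $\Omega\subseteq X$ such that $x$ belongs to the interior of $\Omega$ and $y\in\Omega^c$. For a measure $\mu$ on $X$, the Minkowski content of $A\subseteq X$ is $\mu^+(A):=\liminf_{r\to0}\frac{\mu(B_r(A)\setminus A)}{r}$, where $B_r(A)$ is the $r$-neighbourhood of $A$. For $x,y\in X$, $L\ge1$, let $B^L_{x,y}=B_{Ld(x,y)}(x)\cup B_{Ld(x,y)}(y)$ and $$R^L_{x,y}(z):=\Big(\frac{d(x,z)}{\mathfrak m(B_{d(x,z)}(x))}+\frac{d(y,z)}{\mathfrak m(B_{d(y,z)}(y))}\Big)\chi_{B^L_{x,y}}(z),\qquad R^L_{x,y}(x)=R^L_{x,y}(y)=0,$$ and $\mathfrak m^L_{x,y}:=R^L_{x,y}\,\mathfrak m$, regarded as an outer measure (for arbitrary $A$, $\mathfrak m^L_{x,y}(A)$ is the infimum of $\int_B R^L_{x,y}\,d\mathfrak m$ over Borel $B\supseteq A$). *)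

(* Defs.v *)
From HB Require Import structures.
From mathcomp Require Import all_boot all_order all_algebra.
From mathcomp Require Import all_classical all_reals all_analysis.

Set Implicit Arguments.
Unset Strict Implicit.
Unset Printing Implicit Defensive.

Import Order.TTheory GRing.Theory Num.Theory.
Import numFieldNormedType.Exports.

Local Open Scope classical_set_scope.
Local Open Scope ring_scope.

(* The library's measurable types are pointed.  Since a metric measure space
   carries a nonzero measure it is nonempty, so pointedness is no restriction. *)
#[short(type="pmetricType")]
HB.structure Definition PointedMetric (K : numDomainType) :=
  {M of Metric K M & Pointed M}.

Section metric_measure_space.
Context (R : realType) (X : pmetricType R).
Implicit Types (x y z : X) (A : set X).

Local Notation borel := (g_sigma_algebraType (@open X)).

Definition separable := exists2 D : set X, countable D & dense D.

Definition metric_bounded A := exists z r, A `<=` ball z r.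

(* Radon outer measure in the sense of Federer and Mattila; outer regularity
   on arbitrary sets entails Borel regularity. *)
Definition radon (m : set X -> \bar R) :=
  [/\ forall U, open U -> m.-caratheodory U,
      forall K, compact K -> (m K < +oo)%E,
      forall U, open U ->
        m U = ereal_sup [set m K | K in [set K | compact K /\ K `<=` U]] &
      forall A, m A = ereal_inf [set m U | U in [set U | open U /\ A `<=` U]]].

Definition is_metric_measure_space (m : {outer_measure set X -> \bar R}) :=
  [/\ separable, m setT <> 0%E, radon m &
      forall A, metric_bounded A -> (m A < +oo)%E].

Definition doubling (CD : R) (m : set X -> \bar R) :=
  forall x (r : R), 0 < r -> (m (ball x (2 * r)) <= CD%:E * m (ball x r))%E.

Definition Lip : set (X -> R) :=
  [set u | exists K : R, forall w z, `|u w - u z| <= K * mdist w z].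

(* The supremum of the empty set is -oo in \bar R, whence the case split. *)
Definition lip (u : X -> R) z : \bar R :=
  if `[< isolated setT z >] then 0%E
  else lim (ereal_sup [set (`|u w - u z| / mdist z w)%:E
                      | w in ball z e `\ z] @[e --> (0 : R)^'+]).

(* p lists q_1, ..., q_N: the chain itself is x :: p, with q_0 = x. *)
Definition chains (e : R) x y : set (seq X) :=
  [set p | path (fun a b => mdist a b <= e) x p /\ last x p = y].

Definition chain_integral (g : X -> \bar R) x (p : seq X) : \bar R :=
  let q := nth x (x :: p) in
  (\sum_(i < size p)
     (g (q i) + g (q i.+1)) * (2^-1)%:E * (mdist (q i) (q i.+1))%:E)%E.

Definition chain_width x y A : \bar R :=
  lim (ereal_inf [set chain_integral (fun z => (\1_A z)%:E) x p
                 | p in chains e x y] @[e --> (0 : R)^'+]).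

Definition SS_top x y : set (set X) :=
  [set Omega | [/\ closed Omega, Omega° x & ~ Omega y]].

Definition neighbourhood (r : R) A := \bigcup_(a in A) ball a r.

Definition minkowski_content (mu : set X -> \bar R) A : \bar R :=
  limf_einf (fun r : R => mu (neighbourhood r A `\` A) * (r^-1)%:E)%E
            (0 : R)^'+.

Definition twoballs (L : R) x y : set X :=
  ball x (L * mdist x y) `|` ball y (L * mdist x y).

Definition riesz (m : set X -> \bar R) (L : R) x y z : R :=
  if (z == x) || (z == y) then 0
  else (mdist x z / fine (m (ball x (mdist x z))) +
        mdist y z / fine (m (ball y (mdist y z)))) * \1_(twoballs L x y) z.

Definition riesz_measure (m : set X -> \bar R) (L : R) x y A : \bar R :=
  ereal_inf [set (\int[m : set borel -> \bar R]_(z in B) (riesz m L x y z)%:E)%E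
            | B in [set B : set borel | measurable B /\ A `<=` B]].

Definition pointwise_poincare (m : set X -> \bar R) x y (C L : R) :=
  forall u, Lip u ->
    (`|u x - u y|%:E <=
     C%:E * \int[riesz_measure m L x y : set borel -> \bar R]_z lip u z)%E.

Definition chain_width_bound (m : set X -> \bar R) x y (C L : R) :=
  forall A, (chain_width x y A <= C%:E * riesz_measure m L x y A)%E.

Definition minkowski_content_bound (m : set X -> \bar R) x y (c L : R) :=
  forall Omega, SS_top x y Omega ->
    (c%:E <= minkowski_content (riesz_measure m L x y) Omega)%E.

End metric_measure_space.

Section quantitative.
Context (R : realType).

(* A property of a pair of points of a metric measure space, depending on the
   two constants C > 0 and L >= 1. *)
Definition two_constant_property :=
  forall X : pmetricType R, (set X -> \bar R) -> X -> X -> R -> R -> Prop.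

(* The constants C' and L' are chosen before the space and the points, hence
   depend only on CD, C and L. *)
Definition quant_implies (P Q : two_constant_property) :=
  forall CD C L : R, 1 <= CD -> 0 < C -> 1 <= L ->
  exists C' L' : R, [/\ 0 < C', 1 <= L' &
    forall (X : pmetricType R) (m : {outer_measure set X -> \bar R}) (x y : X),
      is_metric_measure_space m -> doubling CD m ->
      P X m x y C L -> Q X m x y C' L'].

Definition quant_equiv (P Q : two_constant_property) :=
  quant_implies P Q /\ quant_implies Q P.

End quantitative.

(* Main.v *)
Require Import Defs.
From HB Require Import structures.
From mathcomp Require Import all_boot all_order all_algebra.
From mathcomp Require Import all_classical all_reals all_analysis.
From mathcomp Require Import measurable_realfun.
From mathcomp Require Import ring lra.

Set Implicit Arguments.
Unset Strict Implicit.
Unset Printing Implicit Defensive.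

Import Order.TTheory GRing.Theory Num.Theory.
Import numFieldNormedType.Exports.

Local Open Scope classical_set_scope.
Local Open Scope ring_scope.

(** Write mu for the Riesz measure of the pair (x, y), truncated at scale L.
By the doubling condition it is a finite Borel measure, extended to arbitrary
sets by taking the infimum over Borel supersets.  From there on the argument is
about a finite Borel measure on a metric space: the three properties imply one
another in a cycle, always with the same L, and with the constants C, 1/C and
1/c.

From the Poincare inequality to the chain width ([poincare_chain_width]).  By
outer regularity A may be replaced with an open set U of almost the same
measure.  Let phi z be the least cost, for the indicator of a set V, of an
e-chain from x to z.  At scale e the function phi is 1-Lipschitz on V and
constant off V, so that lip phi <= 1 on the closure of V and lip phi = 0
elsewhere; if the closure of V lies in U then phi y <= C mu(U).  It would be of
no use to take V = U, because the boundary of U may have a large measure: U may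
be dense.  Instead V is the dl-core of U, the set of the centres of the balls of
radius dl contained in U, and one has to return from V to U when dl tends to 0
([chain_cost_core]).  A cheap chain may be shortened so that the two steps
around a point of V have a total length of more than e ([shorten_chain]); each
point of V then costs at least e/2, and the number of these points is bounded
independently of dl.  A point off V is at distance less
than dl from a point off U, and moving it there lengthens each step by at most
2 dl: the cost for U of the moved chain exceeds the cost for V of the original
one by a multiple of dl.

From the chain width to the Minkowski content ([chain_width_minkowski]).  An
e-chain that leaves Omega and later leaves its r-neighbourhood spends a length
of at least r - 2e in the annulus between them ([annulus_crossing]).  The chain
width of the annulus is therefore at least r, and its measure at least r / C.

From the Minkowski content to the Poincare inequality ([minkowski_poincare]).
This is the coarea inequality: each superlevel set {u >= t}, for t between u y
and u x, separates x from y and has a content at least c.  The annulus of width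
r around it is the section at t of the region of the pairs (z, t) such that
u z <= t <= u z + r g_r z, where g_r z is the largest slope of u between z and
a point of the ball of radius r about z.  The theorem of Tonelli evaluates the
measure of this region, the lemma of Fatou bounds the integral of the contents
from above by the limit of the integrals of g_r, and this limit is the integral
of lip u by dominated convergence, which uses the finiteness of mu.

The finiteness itself ([integral_ball_ratio]) results from a sum over dyadic
annuli around each of the two points: on the annulus of radii s/2 and s the
density is at most s / m(B_{s/2}), so that its integral there is at most
CD s. *)

(** * Chains and their cost *)

Section chains.
Context (R : realType) (X : pmetricType R).
Implicit Types (x y z a : X) (A U V : set X) (p : seq X) (e r : R).

Definition edge_cost A x y : R := (\1_A x + \1_A y) / 2 * mdist x y.

Fixpoint chain_cost A x p : R :=
  if p is y :: p' then edge_cost A x y + chain_cost A y p' else 0.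

Lemma chain_integral_indic A x p :
  chain_integral (fun z => (\1_A z)%:E) x p = (chain_cost A x p)%:E.
Proof.
rewrite /chain_integral; elim: p x => [|y p IHp] x /=; first by rewrite big_ord0.
rewrite big_ord_recl /= EFinD -IHp; congr (_ + _)%E.
apply: eq_bigr => i _ /=.
by rewrite !(set_nth_default y x) //= add0n // ltnS ltnW.
Qed.

Lemma indic_ge0 A x : 0 <= \1_A x :> R.
Proof. by rewrite indicE ler0n. Qed.

Lemma indic_le1 A x : \1_A x <= 1 :> R.
Proof. by rewrite indicE lern1 leq_b1. Qed.

Lemma edge_cost_ge0 A x y : 0 <= edge_cost A x y.
Proof.
by rewrite mulr_ge0 ?mdist_ge0// divr_ge0// addr_ge0 ?indic_ge0.
Qed.

Lemma edge_cost_sym A x y : edge_cost A x y = edge_cost A y x.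
Proof. by rewrite /edge_cost addrC metric_sym. Qed.

Lemma edge_cost_le A x y : edge_cost A x y <= mdist x y.
Proof.
rewrite ler_piMl ?mdist_ge0//.
by have := indic_le1 A x; have := indic_le1 A y; lra.
Qed.

Lemma chain_cost_ge0 A x p : 0 <= chain_cost A x p.
Proof.
by elim: p x => //= y p IHp x; rewrite addr_ge0 ?edge_cost_ge0.
Qed.

Lemma chain_cost_rcons A x p y :
  chain_cost A x (rcons p y) = chain_cost A x p + edge_cost A (last x p) y.
Proof.
elim: p x => [|q p IHp] x /=; first by rewrite addr0 add0r.
by rewrite IHp addrA.
Qed.

Lemma le_chain_cost A B x p : A `<=` B -> chain_cost A x p <= chain_cost B x p.
Proof.
move=> AB; have indicS z : \1_A z <= \1_B z :> R.
  rewrite !indicE; have [/set_mem/AB/mem_set->//|_] := boolP (z \in A).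
  by rewrite ler0n.
elim: p x => //= y p IHp x; rewrite lerD// ler_wpM2r ?mdist_ge0//.
by rewrite ler_pM2r// lerD.
Qed.

(** An induction on the chain that follows the current point z together with
any point a of Omega.  Each step inside the annulus is fully charged and
increases the distance to a by at most its length; a step that lands in Omega
allows a to be reset to the landing point.  The two half-charged steps, those
that enter and leave the annulus, are the reason for the loss of e at both ends:
hence the maximum with e on one side, and r - e on the other. *)
Lemma annulus_crossing (Omega : set X) r e p z a :
  0 <= e -> path (fun u v => mdist u v <= e) z p -> Omega a ->
  ~ neighbourhood r Omega (last z p) ->
  r - e - Num.max e (mdist a z) <=
    chain_cost (neighbourhood r Omega `\` Omega) z p.
Proof.
move=> e0; set A := _ `\` _.
have far b v : Omega b -> ~ neighbourhood r Omega v -> r <= mdist b v.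
  move=> Ob nv; rewrite leNgt; apply/negP => bv; apply: nv.
  by exists b => //; rewrite ballEmdist.
elim: p z a => [|v p IHp] z a /=.
  move=> _ Oa /(far _ _ Oa) raz.
  have : mdist a z <= Num.max e (mdist a z) by rewrite le_max lexx orbT.
  lra.
case/andP=> zv vp Oa nv.
have [Ov|nOv] := pselect (Omega v).
  have := IHp v v vp Ov nv; have := edge_cost_ge0 A z v.
  rewrite mdistxx.
  rewrite (max_idPl e0); have : e <= Num.max e (mdist a z) by rewrite le_max lexx.
  lra.
have [Oz|nOz] := pselect (Omega z).
  have := IHp v z vp Oz nv; have := edge_cost_ge0 A z v.
  rewrite (max_idPl zv); have : e <= Num.max e (mdist a z) by rewrite le_max lexx.
  lra.
have amax : mdist a z <= Num.max e (mdist a z) by rewrite le_max lexx orbT.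
have emax : e <= Num.max e (mdist a z) by rewrite le_max lexx.
have [Nz|nNz] := pselect (neighbourhood r Omega z); last first.
  have := far a z Oa nNz; have := edge_cost_ge0 A z v.
  have := chain_cost_ge0 A v p; lra.
have [Nv|nNv] := pselect (neighbourhood r Omega v); last first.
  have := far a v Oa nNv; have := edge_cost_ge0 A z v.
  have := chain_cost_ge0 A v p; have := metric_triangle a z v; lra.
have -> : edge_cost A z v = mdist z v.
  rewrite /edge_cost !indicE !mem_set//=; lra.
have := IHp v a vp Oa nv; have := metric_triangle a z v.
have : Num.max e (mdist a v) <= Num.max e (mdist a z) + mdist z v.
  have := mdist_ge0 z v; have := metric_triangle a z v.
  by rewrite ge_max; move=> *; apply/andP; split; lra.
lra.
Qed.

(** * Perturbing a chain *)

Definition visits A p : R := \sum_(q <- p) \1_A q.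

Lemma visits_cons A x p : visits A (x :: p) = \1_A x + visits A p.
Proof. by rewrite /visits big_cons. Qed.

Lemma visits_ge0 A p : 0 <= visits A p.
Proof. by rewrite sumr_ge0// => q _; exact: indic_ge0. Qed.

(** No interior point of A can be skipped while keeping all the steps at most
e: the triangle inequality would allow it as soon as its two adjacent steps have
a total length at most e. *)
Fixpoint irredundant A e x p : Prop :=
  if p is y :: p' then
    (if p' is z :: _ then A y -> e < mdist x y + mdist y z else True)
      /\ irredundant A e y p'
  else True.

(** Summation by parts: up to boundary terms, twice the cost is the sum over
the visits to A of the lengths of the two adjacent steps, each such sum being
more than e.  The summand e accounts for the last point. *)
Lemma irredundant_visits A e x p : 0 <= e -> irredundant A e x p ->
  e * visits A p <= 2 * chain_cost A x p - \1_A x * mdist x (head x p) + e.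
Proof.
move=> e0; elim: p x => [|y p IHp] x /=.
  by rewrite /visits big_nil mdistxx; lra.
case: p IHp => [|z p] IHp.
  rewrite visits_cons /visits big_nil /= /edge_cost => _.
  have := indic_le1 A y; have := indic_ge0 A y.
  have : 0 <= \1_A y * mdist x y by rewrite mulr_ge0 ?indic_ge0 ?mdist_ge0.
  by nra.
case=> exyz /IHp; rewrite (visits_cons A y) [head _ _]/=.
move: (visits _ (z :: p)) (chain_cost _ _ _) => v c; rewrite /edge_cost.
rewrite [\1_A y]indicE.
by have [/set_mem /exyz|_] := boolP (y \in A); rewrite /=; nra.
Qed.

Lemma not_irredundantP A e x p :
  path (fun u v => mdist u v <= e) x p -> ~ irredundant A e x p ->
  exists p', [/\ (size p' < size p)%N,
    path (fun u v => mdist u v <= e) x p', last x p' = last x p &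
    chain_cost A x p' <= chain_cost A x p].
Proof.
elim: p x => [|y p IHp] x //=.
case: p IHp => [|z p] IHp; first by move=> _ [].
move=> /andP[xy yzp] /not_andP[/not_implyP[Ay /negP]|nirr].
  rewrite -leNgt => xyz; exists (z :: p) => /=; move: yzp => /= /andP[yz zp].
  split => //; first by rewrite zp (le_trans (metric_triangle x y z)).
  rewrite addrA lerD2r /edge_cost [\1_A y]indicE mem_set//=.
  have : (\1_A x + \1_A z) / 2 * mdist x z <=
      (\1_A x + \1_A z) / 2 * (mdist x y + mdist y z).
    by rewrite ler_wpM2l ?metric_triangle// divr_ge0// addr_ge0 ?indic_ge0.
  have := indic_le1 A x; have := indic_le1 A z.
  have := mdist_ge0 x y; have := mdist_ge0 y z; nra.
have [q [sq pq lq cq]] := IHp y yzp nirr.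
exists (y :: q); split => //=; first by rewrite xy.
by rewrite lerD2l.
Qed.

(** Skipping a point of A never increases the cost, so the process of skipping
ends with an irredundant chain which is no more expensive. *)
Lemma shorten_chain A e x p : 0 <= e -> path (fun u v => mdist u v <= e) x p ->
  exists p', [/\ path (fun u v => mdist u v <= e) x p', last x p' = last x p,
    chain_cost A x p' <= chain_cost A x p &
    e * visits A p' <= 2 * chain_cost A x p' + e].
Proof.
move=> e0; have [n] := ubnP (size p); elim: n p => // n IHn p pn xp.
have [irr|/(not_irredundantP xp)[q [qp xq lq cq]]] :=
  pselect (irredundant A e x p).
  exists p; split => //; have := irredundant_visits e0 irr.
  have : 0 <= \1_A x * mdist x (head x p).
    by rewrite mulr_ge0 ?indic_ge0 ?mdist_ge0.
  lra.
have [q' [xq' lq' cq' vq']] := IHn q (leq_trans qp pn) xq.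
by exists q'; split => //; [rewrite lq'|exact: le_trans cq' cq].
Qed.

Lemma move_chain A B (f : X -> X) dl e x p :
  (forall q, mdist q (f q) <= dl) -> (forall q, B (f q) <-> A q) ->
  path (fun u v => mdist u v <= e) x p ->
  path (fun u v => mdist u v <= e + 2 * dl) (f x) (map f p) /\
  chain_cost B (f x) (map f p) <=
    chain_cost A x p + dl * \1_A x + 2 * dl * visits A p.
Proof.
move=> fdl BfA; have indf q : \1_B (f q) = \1_A q :> R.
  by rewrite !indicE; congr (nat_of_bool _)%:R; apply/idP/idP;
    rewrite !inE => /BfA.
have dl0 : 0 <= dl by exact: le_trans (mdist_ge0 _ _) (fdl x).
have dist_f q q' : mdist (f q) (f q') <= mdist q q' + 2 * dl.
  have := metric_triangle (f q) q (f q'); have := metric_triangle q q' (f q').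
  have := fdl q; have := fdl q'; rewrite (metric_sym (f q) q); lra.
elim: p x => [|y p IHp] x /=.
  move=> _; rewrite /visits big_nil mulr0 addr0 add0r mulr_ge0 ?indic_ge0//.
move=> /andP[xy /IHp[yp cyp]]; split.
  by rewrite yp andbT (le_trans (dist_f _ _))// lerD2r.
rewrite visits_cons; have : edge_cost B (f x) (f y) <=
    (\1_A x + \1_A y) / 2 * (mdist x y + 2 * dl).
  by rewrite /edge_cost !indf ler_wpM2l// divr_ge0// addr_ge0 ?indic_ge0.
have -> : edge_cost A x y = (\1_A x + \1_A y) / 2 * mdist x y by [].
lra.
Qed.

Definition core dl U : set X := [set z | ball z dl `<=` U].


Lemma open_core U x : open U -> \forall dl \near 0^'+, U x -> core dl U x.
Proof.
move=> oU; have [Ux|nUx] := pselect (U x); last by near=> dl.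
have /nbhs_ballP[r /= r0 rU] : nbhs x U by exact: open_nbhs_nbhs.
near=> dl => _; apply: subset_trans rU; apply: le_ball.
by near: dl; exact: nbhs_right_le.
Unshelve. all: by end_near. Qed.

(** Cheap chains for the cores of U yield cheap chains for U.  After shortening,
the number of visits to the core is at most m, whatever dl is; the chain is then
moved by at most dl, in such a way that exactly the points of the core end up
in U. *)
Lemma chain_cost_core U x y e e' K eta :
  0 < e -> e < e' -> 0 < eta -> open U ->
  (\forall dl \near 0^'+,
    exists2 p, chains e x y p & chain_cost (core dl U) x p <= K) ->
  exists2 p, chains e' x y p & chain_cost U x p <= K + eta.
Proof.
move=> e0 ee' eta0 oU chainK.
pose m := `|2 * K + e| / e.
have m0 : 0 <= m by rewrite divr_ge0// ltW.
have M0 : 0 < 1 + 2 * m by lra.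
near (0 : R)^'+ => dl.
have dl0 : 0 < dl by near: dl; exact: nbhs_right_gt.
have xcore : U x -> core dl U x by near: dl; exact: open_core.
have ycore : U y -> core dl U y by near: dl; exact: open_core.
have dlM : dl * (1 + 2 * m) <= eta.
  by rewrite -ler_pdivlMr//; near: dl; apply: nbhs_right_le; exact: divr_gt0.
have dle : e + 2 * dl <= e'.
  suff : dl <= (e' - e) / 2 by lra.
  by near: dl; apply: nbhs_right_le; rewrite divr_gt0// subr_gt0.
have [p0 [xp0 p0y] p0K] : exists2 p, chains e x y p &
  chain_cost (core dl U) x p <= K by near: dl.
have [p [xp py pp0 visp]] := shorten_chain (core dl U) (ltW e0) xp0.
have coreU : core dl U `<=` U by move=> z; apply; exact: ballxx.
(* Points on which U and its core agree stay put, the others leave U; for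
   small dl both endpoints are among the former. *)
have /choice[f fP] : forall q, exists q', [/\ mdist q q' <= dl,
    U q' <-> core dl U q & (U q -> core dl U q) -> q' = q].
  move=> q; have [Ucore|/not_implyP[Uq /existsNP[q' /not_implyP[qq' nUq']]]] :=
    pselect (U q -> core dl U q).
    by exists q; split; rewrite ?mdistxx ?ltW//; split => //; exact: coreU.
  exists q'; split.
  - by move: qq'; rewrite ballEmdist => /ltW.
  - by split=> // /(_ _ qq').
  - by move=> /(_ Uq _ qq').
have fx : f x = x by have [_ _ ->] := fP x.
have fy : f y = y by have [_ _ ->] := fP y.
have [] := @move_chain (core dl U) U f dl e x p.
- by move=> q; have [] := fP q.
- by move=> q; have [] := fP q.
- by [].
rewrite fx => xfp costfp; exists (map f p); first split.
- by apply: sub_path xfp => u v /le_trans; exact.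
- by rewrite -{1}fx last_map py p0y.
- have visM : visits (core dl U) p <= m.
    rewrite ler_pdivlMr// mulrC (le_trans visp)// (le_trans _ (ler_norm _))//.
    by rewrite lerD2r; lra.
  have := indic_le1 (core dl U) x; move: dlM.
  have := @visits_ge0 (core dl U) p; move: visM.
  move=> vm v0 dlm i1.
  have : dl * (\1_(core dl U) x + 2 * visits (core dl U) p) <= dl * (1 + 2 * m).
    by apply: ler_wpM2l; [exact: ltW|lra].
  lra.
Unshelve. all: by end_near. Qed.
End chains.

(** * Borel sets and continuous functions in a metric space *)

Section metric_topology.
Context (R : realType) (X : pmetricType R).
Implicit Types (x y z w : X).

Lemma open_mball x (r : R) : open (ball x r).
Proof.
rewrite openE => y; rewrite ballEmdist /= => xy.
apply/nbhs_ballP; exists (r - mdist x y); first by rewrite /= subr_gt0.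
move=> z; rewrite !ballEmdist /= => yz.
by have := metric_triangle x y z; lra.
Qed.

Lemma mlipschitz_continuous (u : X -> R) (K : R) :
  (forall w z, `|u w - u z| <= K * mdist w z) -> continuous u.
Proof.
move=> uK z; apply/cvgrPdist_lt => eps eps0; near=> w.
have wz : mdist w z < eps / (`|K| + 1).
  have : ball z (eps / (`|K| + 1)) w.
    by near: w; apply: nbhsx_ballx; rewrite divr_gt0// ltr_wpDl.
  by rewrite ballEmdist /= metric_sym.
rewrite distrC (le_lt_trans (uK w z))//.
have K1 : 0 < `|K| + 1 by rewrite ltr_wpDl.
move: wz; rewrite ltr_pdivlMr// mulrC; apply: le_lt_trans.
by rewrite ler_wpM2r ?mdist_ge0// (le_trans (ler_norm _))// lerDl.
Unshelve. all: by end_near. Qed.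

Lemma mdist_continuous x : continuous (mdist x : X -> R).
Proof.
apply: (@mlipschitz_continuous _ 1) => w z; rewrite mul1r ler_norml.
have := metric_triangle x w z; have := metric_triangle x z w.
by rewrite (metric_sym z w) => *; apply/andP; split; lra.
Qed.

Lemma open_lt_fun (T : topologicalType) (f g : T -> R) :
  continuous f -> continuous g -> open [set z | f z < g z].
Proof.
move=> cf cg; rewrite (_ : [set _ | _] = (g \- f) @^-1` [set t | 0 < t]).
  apply: open_comp; last exact: open_gt.
  by move=> z _; apply: continuousB; [exact: cg|exact: cf].
by apply/seteqP; split => z /=; rewrite subr_gt0.
Qed.

Let borel := g_sigma_algebraType (@open X).

Lemma open_borel (U : set X) : open U -> measurable (U : set borel).
Proof. exact: sub_sigma_algebra. Qed.

Lemma closed_borel (F : set X) : closed F -> measurable (F : set borel).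
Proof.
by move=> cF; rewrite -(setCK F); apply: measurableC; apply: open_borel;
  exact: closed_openC.
Qed.

Lemma continuous_borel (u : X -> R) :
  continuous u -> measurable_fun setT (u : borel -> R).
Proof.
move=> cu; apply: (measurability _ (RGenOInfty.measurableE R)).
move=> /= _ [_ [a ->] <-]; rewrite setTI; apply: open_borel.
by apply: open_comp => [z _|]; [exact: cu|exact: interval_open].
Qed.

End metric_topology.

(** * The local slope of a function *)

Section slope.
Context (R : realType) (X : pmetricType R).
Implicit Types (z w : X) (u : X -> R) (r c K : R).
Let borel := g_sigma_algebraType (@open X).

(** The term for w = z is 0 / 0 = 0.  Unlike in the definition of lip, the set
of slopes is thus never empty, and isolated points need no special case. *)
Definition slope u r z : \bar R :=
  ereal_sup [set (`|u w - u z| / mdist w z)%:E | w in ball z r].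

Lemma slope_ge0 u r z : 0 < r -> (0 <= slope u r z)%E.
Proof.
move=> r0; apply: ereal_sup_ubound; exists z; first exact: ballxx.
by rewrite subrr normr0 mul0r.
Qed.

Lemma le_slope u r r' z : r <= r' -> (slope u r z <= slope u r' z)%E.
Proof.
move=> rr'; apply: ereal_sup_le => _ [w zw <-]; exists w => //.
exact: le_ball zw.
Qed.

Lemma slope_le u r z c : 0 <= c ->
  (forall w, ball z r w -> `|u w - u z| <= c * mdist w z) ->
  (slope u r z <= c%:E)%E.
Proof.
move=> c0 uc; apply: ge_ereal_sup => _ [w /uc uwz <-]; rewrite lee_fin.
have [->|wz] := eqVneq w z; first by rewrite mdistxx invr0 mulr0.
by rewrite ler_pdivrMr ?mdist_gt0.
Qed.

(** For a fixed w both conditions on z, that w is near z and that the slope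
between w and z exceeds c, are open; the slope function is therefore lower
semicontinuous, and this is how lip is seen to be Borel. *)
Lemma slope_open u r c : 0 <= c -> continuous u ->
  open [set z | (c%:E < slope u r z)%E].
Proof.
move=> c0 cu; rewrite (_ : [set _ | _] =
    \bigcup_w (ball w r `&` [set z | c * mdist w z < `|u w - u z|])).
  apply: bigcup_open => w _; apply: openI; first exact: open_mball.
  apply: open_lt_fun => z.
    by apply: cvgM; [exact: cvg_cst|exact: mdist_continuous].
  by apply: cvg_norm; apply: cvgB; [exact: cvg_cst|exact: cu].
apply/seteqP; split => z /=.
  move=> /ereal_sup_gt[_ [w zw <-]]; rewrite lte_fin => cwz.
  exists w => //; split; first exact: ball_sym.
  have wz : 0 < mdist w z.
    rewrite mdist_gt0; apply: contraTneq cwz => ->.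
    by rewrite mdistxx invr0 mulr0 -leNgt.
  by rewrite /= -ltr_pdivlMr.
move=> [w _ [wz /= cwz]]; have wz0 : 0 < mdist w z.
  rewrite mdist_gt0; apply: contraTneq cwz => ->.
  by rewrite mdistxx mulr0 subrr normr0 ltxx.
apply: (@lt_le_trans _ _ (`|u w - u z| / mdist w z)%:E).
  by rewrite lte_fin ltr_pdivlMr.
by apply: ereal_sup_ubound; exists w => //; exact: ball_sym.
Qed.

Lemma measurable_slope u r : 0 < r -> continuous u ->
  measurable_fun setT (slope u r : borel -> \bar R).
Proof.
move=> r0 cu; apply: (measurability _ (ErealGenOInfty.measurableE R)).
move=> /= _ [_ [c ->]] <-; rewrite setTI; apply: open_borel.
rewrite preimage_itvoy.
have [c0|c0] := leP 0 c; first exact: slope_open.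
rewrite (_ : [set _ | _] = setT); first exact: openT.
apply/seteqP; split => // z _ /=.
by apply: lt_le_trans (slope_ge0 _ _ r0); rewrite lte_fin.
Qed.

Lemma slope_cvg_lip u z : slope u r z @[r --> 0^'+] --> lip u z.
Proof.
have slope_cvg : cvg (slope u r z @[r --> 0^'+]).
  apply: nondecreasing_at_right_is_cvge; near=> a => r r' _ _.
  exact: le_slope.
rewrite /lip; case: asboolP => [[_ [V /nbhs_ballP[a /= a0 aV] Vz]]|nisoz].
  apply: cvg_near_cst; near=> r; apply/le_anti/andP; split.
    apply: slope_le => // w zw; suff -> : w = z by rewrite subrr normr0 mul0r.
    suff : [set z] w by [].
    rewrite -Vz; split => //; apply: aV; apply: le_ball zw.
    by near: r; exact: nbhs_right_le.
  by apply: slope_ge0; near: r; exact: nbhs_right_gt.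
rewrite (_ : lim _ = lim (slope u r z @[r --> 0^'+])) //.
apply: cvg_lim => //; apply: cvg_trans slope_cvg; apply: near_eq_cvg.
near=> r; have r0 : 0 < r by near: r; exact: nbhs_right_gt.
apply/le_anti/andP; split; last first.
  apply: ereal_sup_le => _ [w [zw _] <-]; exists w => //.
  by rewrite (metric_sym w).
apply: ge_ereal_sup => _ [w zw <-].
have [->{w zw}|wz] := eqVneq w z; last first.
  apply: ereal_sup_ubound; exists w; last by rewrite metric_sym.
  by split => //; exact/eqP.
rewrite subrr normr0 mul0r.
have [w [zw wz]] : exists w, ball z r w /\ w <> z.
  apply: contrapT => /forallNP now; apply: nisoz; split; first by rewrite inE.
  exists (ball z r); first exact: nbhsx_ballx.
  apply/seteqP; split=> [w [zw _]|_ ->]; last by split=> //; exact: ballxx.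
  by apply: contrapT => wz; apply: (now w).
apply: (@le_trans _ _ (`|u w - u z| / mdist w z)%:E).
  by rewrite lee_fin divr_ge0// mdist_ge0.
by apply: ereal_sup_ubound; exists w => //; rewrite (metric_sym w).
Unshelve. all: by end_near. Qed.

Lemma lip_ge0 u z : (0 <= lip u z)%E.
Proof.
apply: (cvge_ge _ (@slope_cvg_lip u z)); near=> r; apply: slope_ge0.
by near: r; exact: nbhs_right_gt.
Unshelve. all: by end_near. Qed.

Lemma lip_le u z c r : 0 <= c -> 0 < r ->
  (forall w, ball z r w -> `|u w - u z| <= c * mdist w z) ->
  (lip u z <= c%:E)%E.
Proof.
move=> c0 r0 uc; apply: (cvge_le _ (@slope_cvg_lip u z)); near=> s.
apply: slope_le => // w zw; apply: uc; apply: le_ball zw.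
by near: s; exact: nbhs_right_le.
Unshelve. all: by end_near. Qed.

Lemma harmonic_at_right : @harmonic R @ \oo --> (0 : R)^'+.
Proof.
move=> A; rewrite /at_right => A0.
have A1 : nbhs (0 : R) [set t | 0 < t -> A t] by exact: A0.
have : \forall n \near \oo, 0 < @harmonic R n -> A (harmonic n).
  exact: (@cvg_harmonic R _ A1).
by apply: filterS => n; apply; exact: harmonic_gt0.
Qed.

Lemma slope_cvg_lip_harmonic u z :
  slope u (harmonic n) z @[n --> \oo] --> lip u z.
Proof.
exact: (cvg_comp _ _ harmonic_at_right (@slope_cvg_lip u z)).
Qed.

Lemma measurable_lip u : continuous u ->
  measurable_fun setT (lip u : borel -> \bar R).
Proof.
move=> cu.
apply: (emeasurable_fun_cvg (fun n => slope u (harmonic n) : borel -> \bar R)).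
  by move=> n; apply: measurable_slope => //; exact: harmonic_gt0.
by move=> z _; exact: slope_cvg_lip_harmonic.
Qed.

End slope.

(** * The chain width *)

Section chain_width.
Context (R : realType) (X : pmetricType R).
Implicit Types (x y z w : X) (A U V Omega : set X) (e r : R) (b : \bar R).
Let borel := g_sigma_algebraType (@open X).

Definition chain_inf x y A e : \bar R :=
  ereal_inf [set (chain_cost A x p)%:E | p in chains e x y].

Lemma chain_inf_cvg x y A :
  chain_inf x y A e @[e --> 0^'+] --> chain_width x y A.
Proof.
have -> : chain_width x y A = lim (chain_inf x y A e @[e --> 0^'+]).
  rewrite /chain_width; suff -> : chain_inf x y A = (fun e => ereal_inf
    [set chain_integral (fun z => (\1_A z)%:E) x p | p in chains e x y]) by [].
  apply/funext => e; rewrite /chain_inf; congr ereal_inf.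
  by apply: eq_imagel => p _; rewrite chain_integral_indic.
apply: nonincreasing_at_right_is_cvge; near=> a => r r' _ _ rr'.
apply: ereal_inf_le_tmp => _ [p [xp py] <-]; exists p => //; split => //.
by apply: sub_path xp => u v /le_trans; exact.
Unshelve. all: by end_near. Qed.

Lemma chain_width_ge x y A b :
  (\forall e \near 0^'+, (b <= chain_inf x y A e)%E) ->
  (b <= chain_width x y A)%E.
Proof. by move=> h; exact: (cvge_ge h (@chain_inf_cvg x y A)). Qed.

Lemma chain_width_le x y A b :
  (\forall e \near 0^'+, (chain_inf x y A e <= b)%E) ->
  (chain_width x y A <= b)%E.
Proof. by move=> h; exact: (cvge_le h (@chain_inf_cvg x y A)). Qed.

Lemma le_chain_width x y A B : A `<=` B ->
  (chain_width x y A <= chain_width x y B)%E.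
Proof.
move=> AB; apply: (lee_cvg_to (@chain_inf_cvg x y A) (@chain_inf_cvg x y B)).
near=> e; apply: le_ereal_inf_tmp => _ [p xyp <-].
apply: ge_ereal_inf; exists (chain_cost A x p)%:E; first by exists p.
by rewrite lee_fin le_chain_cost.
Unshelve. all: by end_near. Qed.

Lemma chain_width_annulus x y Omega r : Omega x ->
  ~ neighbourhood r Omega y ->
  (r%:E <= chain_width x y (neighbourhood r Omega `\` Omega))%E.
Proof.
move=> Ox nOy; apply/lee_subgt0Pr => eta eta0; apply: chain_width_ge.
near=> e; apply: le_ereal_inf_tmp => _ [p [xp py] <-].
have e0 : 0 < e by near: e; exact: nbhs_right_gt.
have : e <= eta / 2 by near: e; apply: nbhs_right_le; exact: divr_gt0.
rewrite -EFinB lee_fin; have := annulus_crossing (ltW e0) xp Ox.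
rewrite py => /(_ _ nOy); rewrite mdistxx (max_idPl (ltW e0)); lra.
Unshelve. all: by end_near. Qed.

Lemma chain_width_minkowski (mu : set X -> \bar R) x y (C : R) : 0 < C ->
  (forall A, (chain_width x y A <= C%:E * mu A)%E) ->
  forall Omega, SS_top x y Omega -> (C^-1%:E <= minkowski_content mu Omega)%E.
Proof.
move=> C0 widthC Omega [cO /interior_subset Ox nOy].
have /nbhs_ballP[s /= s0 sO] : nbhs y (~` Omega).
  by apply: open_nbhs_nbhs; split => //; exact: closed_openC.
rewrite /minkowski_content limf_einfE; apply: le_ereal_sup_tmp.
exists (ereal_inf ((fun r => mu (neighbourhood r Omega `\` Omega) * r^-1%:E)%E
   @` [set r | 0 < r < s])).
  exists [set r | 0 < r < s] => //; near=> r; apply/andP; split.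
    by near: r; exact: nbhs_right_gt.
  by near: r; exact: nbhs_right_lt.
apply: le_ereal_inf_tmp => _ [r /andP[r0 rs] <-].
rewrite lee_pdivlMr// lee_pdivrMl//.
apply: le_trans (widthC _); apply: chain_width_annulus => //.
move=> [a Oa ar]; apply: (sO a) => //; apply: ball_sym; apply: le_ball ar.
exact: ltW.
Unshelve. all: by end_near. Qed.

End chain_width.

(** * From the Poincare inequality to the chain width *)

Section chain_distance.
Context (R : realType) (X : pmetricType R).
Variables (V : set X) (e M : R) (x : X).
Hypotheses (e0 : 0 < e) (M0 : 0 <= M).
Implicit Types (z w : X).

Let costs z : set R := [set chain_cost V x p | p in chains e x z] `|` [set M].

(** Truncating at M makes this function finite where no chain arrives, and
Lipschitz although it is controlled only at scale e. *)
Definition chain_distance z : R := inf (costs z).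

Let costs_lb z : lbound (costs z) 0.
Proof. by move=> _ [[p _ <-]|->//]; exact: chain_cost_ge0. Qed.

Let costs_has_inf z : has_inf (costs z).
Proof. by split; [exists M; right|exists 0; exact: costs_lb]. Qed.

Let chain_distance_leM z : chain_distance z <= M.
Proof. by apply: ge_inf; [case: (costs_has_inf z)|right]. Qed.

Lemma chain_distance_ge0 z : 0 <= chain_distance z.
Proof. by apply: lb_le_inf; [exists M; right|exact: costs_lb]. Qed.

Lemma chain_distance_base : chain_distance x = 0.
Proof.
apply/le_anti; rewrite chain_distance_ge0 andbT.
by apply: ge_inf; [case: (costs_has_inf x)|left; exists [::]].
Qed.

Lemma chain_distance_lt z t : chain_distance z < t -> t <= M ->
  exists2 p, chains e x z p & chain_cost V x p < t.
Proof.
move=> zt tM; have [_ [[p xzp <-]|->] st] := inf_lt (costs_has_inf z).1 zt.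
  by exists p.
by move: st; rewrite ltNge tM.
Qed.

Let chain_distance_step z w : mdist z w <= e ->
  chain_distance w <= chain_distance z + edge_cost V z w.
Proof.
move=> zw; rewrite -lerBlDr; apply: lb_le_inf; first by exists M; right.
move=> _ [[p [xp pz] <-]|->]; rewrite lerBlDr; last first.
  by rewrite (le_trans (chain_distance_leM w))// lerDl edge_cost_ge0.
apply: ge_inf; first by case: (costs_has_inf w).
left; exists (rcons p w); last by rewrite chain_cost_rcons pz.
by split; rewrite ?last_rcons// rcons_path xp pz.
Qed.

(** Either point can be appended to a chain that ends at the other. *)
Lemma chain_distance_near z w : mdist z w <= e ->
  `|chain_distance w - chain_distance z| <= edge_cost V z w.
Proof.
move=> zw; rewrite ler_norml; have := chain_distance_step zw.
have := @chain_distance_step w z; rewrite metric_sym => /(_ zw).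
by rewrite (edge_cost_sym V w); move=> *; apply/andP; split; lra.
Qed.

Lemma chain_distance_Lip : Lip chain_distance.
Proof.
exists (1 + M / e) => w z; have Me0 : 0 <= M / e by rewrite divr_ge0// ltW.
have [zw|zw] := leP (mdist z w) e.
  rewrite (le_trans (chain_distance_near zw))// (le_trans (edge_cost_le _ _ _))//.
  by rewrite metric_sym ler_peMl ?mdist_ge0// lerDl.
apply: (@le_trans _ _ (M / e * mdist z w)); last first.
  by rewrite (metric_sym w) ler_wpM2r ?mdist_ge0// lerDr.
apply: (@le_trans _ _ M).
  have := chain_distance_leM w; have := chain_distance_leM z.
  have := chain_distance_ge0 w; have := chain_distance_ge0 z.
  by rewrite ler_norml; move=> *; apply/andP; split; lra.
by rewrite -mulrA ler_peMr// ler_pdivlMl ?mulr1// ltW.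
Qed.

End chain_distance.

Section poincare_to_width.
Context (R : realType) (X : pmetricType R).
Implicit Types (x y z w : X) (A U V Omega : set X) (e r : R) (b : \bar R).
Let borel := g_sigma_algebraType (@open X).

(** A point z off U has a neighbourhood that misses the core of U, and there
the chain distance is constant.  This would fail on the boundary of U if the
core were replaced with U. *)
Lemma lip_chain_distance U dl e M x z : 0 < e -> 0 < dl -> 0 <= M ->
  (lip (chain_distance (core dl U) e M x) z <= (\1_U z)%:E)%E.
Proof.
move=> e0 dl0 M0; have [Uz|nUz] := pselect (U z).
  rewrite indicE mem_set//; apply: (lip_le ler01 e0) => w; rewrite ballEmdist.
  move=> /= /ltW zw; rewrite (le_trans (chain_distance_near _ _ M0 zw))//.
  by rewrite mul1r metric_sym edge_cost_le.
rewrite indicE memNset//; apply: (@lip_le _ _ _ _ _ (Num.min e dl)) => //.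
  by rewrite lt_min e0.
move=> w; rewrite ballEmdist /= lt_min => /andP[/ltW zw zdl].
rewrite (le_trans (chain_distance_near _ _ M0 zw))// /edge_cost !indicE.
have nw : ~ core dl U w.
  by move=> cw; apply: nUz; apply: cw; rewrite ballEmdist /= metric_sym.
have nz : ~ core dl U z by move=> cz; apply: nUz; apply: cz; exact: ballxx.
by rewrite (memNset nw) (memNset nz) addr0 !mul0r.
Qed.

(** The Poincare inequality is applied to the chain distance for the dl-core,
truncated above the value C nu(U) that it must not exceed at y. *)
Lemma poincare_chain_width_open (nu : {measure set borel -> \bar R}) x y (C : R)
    U : 0 < C ->
  (forall u, Lip u -> (`|u x - u y|%:E <= C%:E * \int[nu]_z lip u z)%E) ->
  open U -> (nu U < +oo)%E -> (chain_width x y U <= C%:E * nu U)%E.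
Proof.
move=> C0 poincare oU nuU.
have nuUfin : nu U \is a fin_num by rewrite ge0_fin_numE.
set K := C * fine (nu U).
have -> : (C%:E * nu U)%E = K%:E by rewrite EFinM fineK.
have K0 : 0 <= K by rewrite mulr_ge0 ?fine_ge0// ltW.
apply: chain_width_le; near=> e.
have e0 : 0 < e by near: e; exact: nbhs_right_gt.
apply/lee_addgt0Pr => eta eta0.
have eta20 : 0 < eta / 2 by rewrite divr_gt0.
have e20 : 0 < e / 2 by rewrite divr_gt0.
have ee : e / 2 < e by lra.
have [|p xyp pK] := @chain_cost_core _ _ U x y (e / 2) e (K + eta / 2) (eta / 2)
  e20 ee eta20 oU.
  near=> dl; have dl0 : 0 < dl by near: dl; exact: nbhs_right_gt.
  pose phi := chain_distance (core dl U) (e / 2) (K + eta / 2) x.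
  have M0 : 0 <= K + eta / 2 by lra.
  have lipphi : Lip phi by exact: chain_distance_Lip.
  have : ((phi y)%:E <= K%:E)%E.
    have -> : phi y = `|phi x - phi y|.
      by rewrite /phi chain_distance_base// sub0r normrN ger0_norm//
        chain_distance_ge0.
    apply: (le_trans (poincare _ lipphi)); rewrite /K EFinM fineK//.
    rewrite lee_pmul2l// -[in leRHS](setIT U).
    have mU : measurable (U : set borel) by exact: open_borel.
    rewrite -(@integral_indic _ borel)//; apply: ge0_le_integral => //.
    - by move=> z _; exact: lip_ge0.
    - apply: measurable_lip; have [k phik] := lipphi.
      exact: mlipschitz_continuous phik.
    - apply/measurable_EFinP; exact: measurable_indic.
    - by move=> z _; exact: lip_chain_distance.
  rewrite lee_fin => phiK.
  have philt : phi y < K + eta / 2 by rewrite (le_lt_trans phiK)// ltrDl.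
  have [p xyp pK] := chain_distance_lt M0 philt (lexx _).
  by exists p => //; exact: ltW.
apply: ge_ereal_inf; exists (chain_cost U x p)%:E; first by exists p.
by rewrite -EFinD lee_fin (le_trans pK)//; lra.
Unshelve. all: by end_near. Qed.

End poincare_to_width.

(** * Outer regularity of finite Borel measures *)

Section regularity.
Context (R : realType) (X : pmetricType R).
Let borel := g_sigma_algebraType (@open X).
Variable nu : {finite_measure set borel -> \bar R}.
Implicit Types (A B U F : set borel) (eps : R).

Lemma decreasing_measure_lt (F : (set borel)^nat) eps :
  (forall n, measurable (F n)) -> {homo F : n m / (n <= m)%N >-> (m <= n)%O} ->
  (nu (\bigcap_n F n) < eps%:E)%E -> exists n, (nu (F n) < eps%:E)%E.
Proof.
move=> mF dF nuF.
have F0 : (nu (F 0%N) < +oo)%E by rewrite -ge0_fin_numE// fin_num_measure.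
have := nonincreasing_cvg_mu F0 mF (bigcapT_measurable mF) dF.
have /[swap]/[apply] : nbhs (nu (\bigcap_n F n)) [set t | (t < eps%:E)%E].
  by apply: open_nbhs_nbhs; split => //; exact: open_ereal_lt_ereal.
by case=> n _ nF; exists n; apply: nF => /=.
Qed.

(** Approximability from inside and outside at once is stable under complements;
the sets that enjoy it form a sigma-algebra. *)
Let squeezed B := forall eps, 0 < eps -> exists U F : set X,
  [/\ open U, closed F, F `<=` B, B `<=` U & (nu (U `\` F) < eps%:E)%E].

(** An open set is the increasing union of its cores, which are closed. *)
Let squeezed_open (U : set X) : open U -> squeezed U.
Proof.
move=> oU eps eps0.
have coreC dl : open (~` core dl U).
  rewrite (_ : ~` _ = \bigcup_(q in ~` U) ball q dl).
    by apply: bigcup_open => q _; exact: open_mball.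
  apply/seteqP; split => [z /existsNP[q /not_implyP[zq nUq]]|z [q nUq qz] zU].
    by exists q => //; exact: ball_sym.
  exact: (nUq (zU q (ball_sym qz))).
have coreS n m : (n <= m)%N -> core (harmonic n) U `<=` core (@harmonic R m) U.
  move=> nm z zU w zw; apply: zU; apply: le_ball zw.
  by rewrite lef_pV2 ?posrE// ler_nat ltnS.
have [|||n nU] := @decreasing_measure_lt (fun n => U `\` core (harmonic n) U) eps.
- by move=> n; rewrite setDE; apply: measurableI; exact: open_borel.
- by move=> n m nm; apply/subsetPset; apply: setDS; exact: coreS.
- rewrite (_ : \bigcap_n _ = set0) ?measure0// -subset0 => z Uz.
  have [Uz0 _] := Uz 0%N I.
  have : \forall n \near \oo, core (@harmonic R n) U z.
    have : \forall n \near \oo, U z -> core (@harmonic R n) U z.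
      exact: (harmonic_at_right (open_core z oU)).
    by apply: filterS => n; exact.
  by case=> n _ /(_ n (leqnn n)) zn; have [_] := Uz n I.
- exists U, (core (harmonic n) U); split => //.
    by rewrite -(setCK (core _ _)); exact: open_closedC.
  by move=> z; apply; apply: ballxx; exact: harmonic_gt0.
Qed.

Let squeezed_setC B : squeezed B -> squeezed (setT `\` B).
Proof.
move=> sB eps eps0; have [U [F [oU cF FB BU UF]]] := sB eps eps0.
exists (~` F), (~` U); split.
- exact: closed_openC.
- exact: open_closedC.
- by rewrite setTD; exact: subsetC.
- by rewrite setTD; exact: subsetC.
- by rewrite setDE setCK setIC -setDE.
Qed.

(** A countable union of closed sets need not be closed, so it is truncated to
a finite union, at the cost of another small set. *)
Let squeezed_bigcup (B : (set borel)^nat) :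
  (forall n, squeezed (B n)) -> squeezed (\bigcup_n B n).
Proof.
move=> sB eps eps0; pose eps2 := eps / 2.
have eps20 : 0 < eps2 by rewrite divr_gt0.
have : forall n, exists UF : set X * set X, [/\ open UF.1, closed UF.2,
    UF.2 `<=` B n, B n `<=` UF.1 &
    (nu (UF.1 `\` UF.2) < (eps2 / (2 ^ n.+1)%:R)%:E)%E].
  move=> n; have [|U [F UF]] := sB n (eps2 / (2 ^ n.+1)%:R).
    by rewrite divr_gt0// ltr0n expn_gt0.
  by exists (U, F).
move=> /choice[UF UFP].
pose U := \bigcup_n (UF n).1.
have mU n : measurable ((UF n).1 : set borel).
  by have [/open_borel] := UFP n.
have mF n : measurable ((UF n).2 : set borel).
  by have [_ /closed_borel] := UFP n.
pose F N := \big[setU/set0]_(n < N) (UF n).2.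
have FE N : F N = \bigcup_(n < N) (UF n).2 by rewrite bigcup_mkord.
have [|||N nuN] := @decreasing_measure_lt (fun N => U `\` F N) eps.
- move=> N; apply: measurableD; first exact: bigcupT_measurable.
  by apply: bigsetU_measurable => n _.
- move=> n m nm; apply/subsetPset; apply: setDS; rewrite !FE.
  by move=> z [k /= kn zk]; exists k => //=; exact: leq_trans nm.
- apply: (@le_lt_trans _ _ (\sum_(0 <= n <oo) nu ((UF n).1 `\` (UF n).2))%E).
    apply: measure_sigma_subadditive.
    + by move=> n; exact: measurableD.
    + apply: bigcapT_measurable => N; apply: measurableD.
        exact: bigcupT_measurable.
      by apply: bigsetU_measurable => n _.
    + move=> z zD; have [[n _ zUn] _] := zD 0%N I; exists n => //; split => //.
      have [_] := zD n.+1 I; rewrite FE => zF zFn; apply: zF; exists n => //=.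
  apply: (@le_lt_trans _ _ eps2%:E); last by rewrite lte_fin /eps2; lra.
  have := @epsilon_trick R (cst 0%E) eps2 xpredT (fun _ => lexx _) (ltW eps20).
  rewrite [X in (_ <= X + _)%E -> _]eseries0// add0e; apply: le_trans.
  apply: lee_nneseries => // n _.
  by rewrite add0e ltW//; have [] := UFP n.
- exists U, (F N); split => //.
  + by apply: bigcup_open => n _; have [] := UFP n.
  + by apply: closed_bigsetU => n _; have [] := UFP n.
  + rewrite FE => z [n _ zn]; exists n => //.
    by have [_ _ FB _ _] := UFP n; exact: FB.
  + by move=> z [n _ zn]; exists n => //; have [_ _ _ BU _] := UFP n; exact: BU.
Qed.

Lemma outer_regular B eps : measurable B -> 0 < eps ->
  exists U : set X, [/\ open U, B `<=` U & (nu U <= nu B + eps%:E)%E].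
Proof.
move=> mB eps0; have /(_ eps eps0)[U [F [oU cF FB BU UF]]] : squeezed B.
  apply: mB; split => //; split.
  - by move=> e e0; exists set0, set0; split => //;
      [exact: open0|exact: closed0|rewrite set0D measure0].
  - exact: squeezed_setC.
  - exact: squeezed_bigcup.
exists U; split => //; have mU := open_borel oU; have mF := closed_borel cF.
rewrite -(setDUK BU) measureU//; last 2 first.
- exact: measurableD.
- by rewrite setDE setICA setICr setI0.
rewrite leeD2l// (le_trans _ (ltW UF))// le_measure ?inE//.
- exact: measurableD.
- exact: measurableD.
- exact: setDS.
Qed.

End regularity.

(** * The coarea inequality for the Minkowski content *)

Section coarea.
Context (R : realType) (X : pmetricType R).
Let borel := g_sigma_algebraType (@open X).
Variable nu : {finite_measure set borel -> \bar R}.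
Implicit Types (u : X -> R) (r K : R).
Local Open Scope ereal_scope.

(** The section at z is an interval of length r * slope u r z, and the section
at t contains the r-annulus around the superlevel set of u at t. *)
Let band u r : set (borel * measurableTypeR R) :=
  [set p | u p.1 <= p.2]%R `&`
  [set p | p.2 <= u p.1 + r * fine (slope u r p.1)]%R.

Let measurable_band u r : (0 < r)%R -> continuous u -> measurable (band u r).
Proof.
move=> r0 cu.
have mu1 : measurable_fun setT (fun p : borel * measurableTypeR R => u p.1).
  by apply: (measurableT_comp (continuous_borel cu)); exact: measurable_fst.
have m2 : measurable_fun setT (fun p : borel * measurableTypeR R => p.2).
  exact: measurable_snd.
apply: measurableI; rewrite -[X in measurable X]setTI;
  apply: measurable_fun_le => //.
apply: measurable_funD => //; apply: measurable_funM => //.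
apply: measurableT_comp => //; apply: (measurableT_comp (measurable_slope r0 cu)).
exact: measurable_fst.
Qed.

Let level_annulus u r K t : (0 < r)%R ->
  (forall w z, `|u w - u z| <= K * mdist w z)%R ->
  neighbourhood r [set z | t <= u z]%R `\` [set z | t <= u z]%R `<=`
    ysection (band u r) t.
Proof.
move=> r0 uK z [[a /= ta az] /negP]; rewrite -ltNge => zt.
rewrite /ysection /= inE; split => /=; first exact: ltW.
have sfin : slope u r z \is a fin_num.
  rewrite ge0_fin_numE ?slope_ge0//.
  apply: (@le_lt_trans _ _ `|K|%:E); last exact: ltry.
  apply: slope_le => // w _; rewrite (le_trans (uK _ _))//.
  by rewrite ler_wpM2r ?mdist_ge0// ler_norm.
have za : a != z by apply: contraTneq ta => ->; rewrite -ltNge.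
have za0 : (0 < mdist a z)%R by rewrite mdist_gt0.
have : (`|u a - u z| / mdist a z <= fine (slope u r z))%R.
  rewrite -lee_fin fineK//; apply: ereal_sup_ubound; exists a => //.
  exact: ball_sym.
rewrite ler_pdivrMr// => uaz; rewrite (le_trans ta)// -lerBlDl.
rewrite (le_trans (ler_norm _))// (le_trans uaz)// mulrC.
apply: ler_wpM2r; first by rewrite fine_ge0// slope_ge0.
by move: az; rewrite ballEmdist => /ltW.
Qed.

Let integral_band u r : (0 < r)%R -> continuous u ->
  (forall z, slope u r z \is a fin_num) ->
  \int[lebesgue_measure]_t nu (ysection (band u r) t) =
  r%:E * \int[nu]_z slope u r z.
Proof.
move=> r0 cu sfin; have mb := measurable_band r0 cu.
have := indic_fubini_tonelli nu (@lebesgue_measure R) mb.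
rewrite (indic_fubini_tonelli_FE _ mb) (indic_fubini_tonelli_GE _ mb) => <-.
rewrite -ge0_integralZl_EFin ?(ltW r0)//; last 2 first.
- by move=> z _; exact: slope_ge0.
- exact: measurable_slope.
apply: eq_integral => z _ /=.
have s0 : (0 <= r * fine (slope u r z))%R.
  by rewrite mulr_ge0 ?(ltW r0)// fine_ge0// slope_ge0.
rewrite (_ : xsection _ _ = `[u z, (u z + r * fine (slope u r z))%R]%classic).
  rewrite lebesgue_measure_itv /= lte_fin ltrDl -EFinB addrC addKr.
  rewrite -[in RHS](fineK (sfin z)) -EFinM.
  move: s0; rewrite le_eqVlt => /predU1P[<-|->//].
  by rewrite ltxx.
apply/seteqP; split => t; rewrite /xsection /= inE in_itv /=.
  by case=> ut tu; apply/andP.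
by move=> /andP[].
Qed.

Let le_limf_limn (F : R -> \bar R) :
  limf_einf F (0%R : R)^'+ <= limn_einf (F \o @harmonic R).
Proof.
rewrite limf_einfE; apply: ge_ereal_sup => _ [V V0 <-].
have : \forall n \near \oo, V (@harmonic R n) by exact: (@harmonic_at_right R _ V0).
case=> N _ VN; rewrite limn_einf_lim.
apply: lime_ge; first exact: is_cvg_einfs.
exists N => // n /= Nn; apply: le_ereal_inf_tmp => _ [m /= nm <-].
apply: ereal_inf_lbound; exists (harmonic m) => //.
by apply: VN; exact: leq_trans nm.
Qed.

Let le_limn_einf (v w : (\bar R)^nat) : (forall n, v n <= w n) ->
  limn_einf v <= limn_einf w.
Proof.
move=> vw; rewrite !limn_einf_lim; apply: lee_lim; [exact: is_cvg_einfs..|].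
apply: nearW => n; apply: le_ereal_inf_tmp => _ [m /= nm <-].
by apply: (le_trans _ (vw m)); apply: ereal_inf_lbound; exists m.
Qed.

(** The lower bound on the contents is integrated over ]a, b[ along the sequence
of radii 1 / (n + 1), by the lemma of Fatou and the computation of the measure
of the bands. *)
Lemma coarea_minkowski u (a b c : R) : Lip u -> (a < b)%R -> (0 <= c)%R ->
  (forall t, (a < t < b)%R ->
    c%:E <= minkowski_content nu [set z | t <= u z]%R) ->
  (c * (b - a))%:E <= \int[nu]_z lip u z.
Proof.
move=> [K uK] ab c0 cmink; have cu := mlipschitz_continuous uK.
have slopeK r z : slope u r z <= `|K|%:E.
  apply: slope_le => // w _; rewrite (le_trans (uK _ _))//.
  by rewrite ler_wpM2r ?mdist_ge0// ler_norm.
have sfin r z : (0 < r)%R -> slope u r z \is a fin_num.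
  move=> r0; rewrite ge0_fin_numE ?slope_ge0//.
  by rewrite (le_lt_trans (slopeK _ _))// ltry.
pose f n t := nu (ysection (band u (harmonic n)) t) * (harmonic n)^-1%:E.
have h0 n : (0 < @harmonic R n)%R by exact: harmonic_gt0.
have mf n : measurable_fun setT (f n).
  apply: emeasurable_funM => //.
  exact: (measurable_fun_ysection nu (measurable_band (h0 n) cu)).
have f0 n t : 0 <= f n t by rewrite mule_ge0// lee_fin invr_ge0 ltW.
have mI : measurable (`]a, b[%classic : set (measurableTypeR R)).
  exact: measurable_itv.
have lhs : (c * (b - a))%:E <=
    \int[lebesgue_measure]_(t in `]a, b[) limn_einf (f^~ t).
  have -> : (c * (b - a))%:E = \int[lebesgue_measure]_(t in `]a, b[) (cst c%:E t).
    rewrite integral_cst// [X in _ = _ * X]lebesgue_measure_itv /= lte_fin ab.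
    by rewrite -EFinB -EFinM.
  apply: ge0_le_integral => //.
  - apply: (emeasurable_fun_cvg (fun n t => einfs (f^~ t) n)).
      by apply: measurable_fun_einfs => n; exact: measurable_funTS.
    by move=> t _; rewrite limn_einf_lim; exact: is_cvg_einfs.
  - move=> t; rewrite /= in_itv /= => /cmink /le_trans; apply.
    apply: le_trans (le_limf_limn _) _; apply: le_limn_einf => n /=.
    rewrite lee_pmul2r ?invr_gt0// le_measure ?inE//.
    + rewrite setDE; apply: measurableI.
        by apply: open_borel; apply: bigcup_open => q _; exact: open_mball.
      apply: open_borel; rewrite (_ : ~` _ = [set z | u z < t]%R).
        by apply: open_lt_fun => //; exact: cst_continuous.
      by apply/seteqP; split => z /=; rewrite ltNge; [move/negP|move=> /negP].
    + exact: measurable_ysection (measurable_band (h0 n) cu).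
    + exact: level_annulus.
have int_f n : \int[lebesgue_measure]_(t in `]a, b[) f n t <=
    \int[nu]_z slope u (harmonic n) z.
  apply: (@le_trans _ _ (\int[lebesgue_measure]_t f n t)).
    exact: ge0_subset_integral.
  under eq_integral do rewrite /f muleC.
  rewrite ge0_integralZl_EFin ?invr_ge0 ?(ltW (h0 n))//; last first.
    exact: (measurable_fun_ysection nu (measurable_band (h0 n) cu)).
  rewrite integral_band//; last by move=> z; exact: sfin.
  by rewrite muleA -EFinM mulVf ?mul1e// gt_eqF// h0.
apply: (le_trans lhs); apply: (le_trans (fatou _ _ _ _)) => //.
  by move=> n; exact: measurable_funTS.
have [] := @dominated_convergence _ borel R nu setT measurableT
  (fun n => slope u (harmonic n)) (lip u) (cst `|K|%:E).
- by move=> n; exact: measurable_slope.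
- exact: measurable_lip.
- by apply: aeW => z _; exact: slope_cvg_lip_harmonic.
- exact: finite_measure_integrable_cst.
- by apply: aeW => z n _; rewrite gee0_abs ?slopeK// slope_ge0.
move=> _ _ cvg_slope; rewrite -((cvg_limn_einf_sup cvg_slope).1).
exact: le_limn_einf.
Qed.
End coarea.

(** * Measures on the Borel sets, and the volume of balls *)

Section density_measure.
Context d (T : measurableType d) (R : realType).
Variables (mu : {measure set T -> \bar R}) (f : T -> \bar R).
Hypotheses (mf : measurable_fun setT f) (f0 : forall x, (0 <= f x)%E)
  (intf : (\int[mu]_x f x < +oo)%E).
Local Open Scope ereal_scope.

Definition density_measure (A : set T) : \bar R := \int[mu]_(x in A) f x.

Let density_measure0 : density_measure set0 = 0.
Proof. exact: integral_set0. Qed.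

Let density_measure_ge0 A : 0 <= density_measure A.
Proof. exact: integral_ge0. Qed.

Let density_measure_fin : fin_num_fun density_measure.
Proof.
move=> A mA; rewrite ge0_fin_numE// (le_lt_trans _ intf)//.
by apply: ge0_subset_integral => //; exact: measurable_funTS.
Qed.

HB.instance Definition _ := isMeasure.Build _ _ _ density_measure
  density_measure0 density_measure_ge0 (semi_sigma_additive_nng_induced mf f0).

HB.instance Definition _ :=
  Measure_isFinite.Build _ _ _ density_measure density_measure_fin.

Lemma finite_density_measure :
  exists nu : {finite_measure set T -> \bar R},
    nu = density_measure :> (set T -> \bar R).
Proof. by exists density_measure. Qed.

End density_measure.

Section borel_restriction.
Context (R : realType) (X : pmetricType R).
Variable m : {outer_measure set X -> \bar R}.
Let borel := g_sigma_algebraType (@open X).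
Hypothesis open_cara : forall U, open U -> m.-caratheodory U.

Lemma borel_caratheodory (A : set borel) : measurable A -> m.-caratheodory A.
Proof.
apply: smallest_sub => //; split.
- exact: caratheodory_measurable_set0.
- by move=> B mB; rewrite setTD; exact: caratheodory_measurable_setC.
- exact: caratheodory_measurable_bigcup.
Qed.

Lemma borel_measure :
  exists mB : {measure set borel -> \bar R}, mB = m :> (set X -> \bar R).
Proof.
have sa : semi_sigma_additive (m : set borel -> \bar R).
  move=> F mF tF mUF.
  apply: (@caratheodory_measure_sigma_additive R X m F) => //.
  - by move=> i; exact: borel_caratheodory.
  - exact: borel_caratheodory.
pose mea := isMeasure.Build _ borel R (m : set borel -> \bar R)
  (outer_measure0 m) (outer_measure_ge0 m) sa.
pose mB : {measure set borel -> \bar R} := HB.pack (m : set borel -> \bar R) mea.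
by exists mB.
Qed.

End borel_restriction.

Section doubling_measure.
Context (R : realType) (X : pmetricType R).
Variables (m : {outer_measure set X -> \bar R}) (CD : R).
Hypotheses (mms : is_metric_measure_space m) (mD : doubling CD m).
Implicit Types (x y z : X) (r : R).
Let borel := g_sigma_algebraType (@open X).

Lemma ball_measure_fin x r : m (ball x r) \is a fin_num.
Proof.
have [_ _ _ mfin] := mms.
by rewrite ge0_fin_numE ?outer_measure_ge0// mfin//; exists x, r.
Qed.

(** By the doubling condition a null ball would have null multiples, and these
exhaust the space. *)
Lemma ball_measure_gt0 x r : 0 < r -> (0 < m (ball x r))%E.
Proof.
move=> r0; rewrite lt0e outer_measure_ge0 andbT; apply/negP => /eqP mxr.
have [_ + _ _] := mms; apply.
have mball n : m (ball x (2 ^+ n * r)) = 0%E.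
  elim: n => [|n IHn]; first by rewrite expr0 mul1r.
  apply/le_anti; rewrite outer_measure_ge0 andbT exprS -mulrA.
  by rewrite (le_trans (mD _ _))// ?mulr_gt0 ?exprn_gt0// IHn mule0.
apply/le_anti; rewrite outer_measure_ge0 andbT.
have <- : \bigcup_n ball x (2 ^+ n * r) = setT.
  apply/seteqP; split=> // z _.
  have [n rn] : exists n, mdist x z / r < n%:R.
    by exists (Num.trunc (mdist x z / r)).+1; exact: truncnS_gt.
  exists n => //; rewrite ballEmdist /= -ltr_pdivrMr// (lt_le_trans rn)//.
  by rewrite -natrX ler_nat ltnW// ltn_expl.
rewrite (le_trans (outer_measure_sigma_subadditive _ _))//.
by rewrite eseries0// => n _; rewrite /= mball.
Qed.

End doubling_measure.

(** * Extension of a Borel measure to arbitrary sets *)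

Section outer_extension.
Context (R : realType) (X : pmetricType R).
Let borel := g_sigma_algebraType (@open X).

Definition outer_extension (nu : set borel -> \bar R) (A : set X) : \bar R :=
  ereal_inf [set nu B | B in [set B : set borel | measurable B /\ A `<=` B]].

Lemma outer_extension_borel (nu : {measure set borel -> \bar R}) (A : set borel) :
  measurable A -> outer_extension nu A = nu A.
Proof.
move=> mA; apply/le_anti/andP; split.
  by apply: ereal_inf_lbound; exists A => //; split.
apply: le_ereal_inf_tmp => _ [B [mB AB] <-].
by rewrite le_measure ?inE.
Qed.

(** The chain width increases with the set, and any Borel set can be replaced
with an open superset of almost the same measure. *)
Lemma poincare_chain_width (nu : {finite_measure set borel -> \bar R})
    x y (C : R) :
  0 < C ->
  (forall u, Lip u -> (`|u x - u y|%:E <= C%:E * \int[nu]_z lip u z)%E) ->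
  forall A, (chain_width x y A <= C%:E * outer_extension nu A)%E.
Proof.
move=> C0 poincare A; rewrite -lee_pdivrMl//.
apply: le_ereal_inf_tmp => _ [B [mB AB] <-]; rewrite lee_pdivrMl//.
apply/lee_addgt0Pr => eta eta0.
have [U [oU BU nuU]] := outer_regular nu mB (divr_gt0 eta0 C0).
apply: le_trans (le_chain_width x y (subset_trans AB BU)) _.
have nuUoo : (nu U < +oo)%E.
  by rewrite -ge0_fin_numE// fin_num_measure//; exact: open_borel.
apply: le_trans (poincare_chain_width_open C0 poincare oU nuUoo) _.
apply: (@le_trans _ _ (C%:E * (nu B + (eta / C)%:E))%E).
  by rewrite lee_pmul2l.
rewrite muleDr//; last by rewrite ge0_adde_def// inE// lee_fin divr_ge0 ?ltW.
by rewrite -EFinM mulrC divfK ?gt_eqF.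
Qed.

End outer_extension.

(** * Finiteness of the Riesz measure *)

Section riesz_density.
Context (R : realType) (X : pmetricType R).
Let borel := g_sigma_algebraType (@open X).
Variables (m : {outer_measure set X -> \bar R}) (CD : R).
Hypotheses (mms : is_metric_measure_space m) (CD1 : 1 <= CD) (mD : doubling CD m).
Variable mB : {measure set borel -> \bar R}.
Hypothesis mBE : mB = m :> (set X -> \bar R).
Implicit Types (x y z : X) (r : R).

(** One of the two terms of the density of the Riesz measure. *)
Definition ball_ratio x z : R := mdist x z / fine (m (ball x (mdist x z))).

Let ball_volume_gt0 x r : 0 < r -> 0 < fine (m (ball x r)).
Proof.
move=> r0; rewrite fine_gt0// (ball_measure_gt0 mms mD)//=.
by rewrite ltey_eq (ball_measure_fin mms).
Qed.

Let le_ball_volume x r s : r <= s -> fine (m (ball x r)) <= fine (m (ball x s)).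
Proof.
move=> rs; rewrite fine_le ?(ball_measure_fin mms)//.
by apply: le_outer_measure; exact: le_ball.
Qed.

Lemma ball_ratio_ge0 x z : 0 <= ball_ratio x z.
Proof. by rewrite divr_ge0 ?mdist_ge0// fine_ge0// outer_measure_ge0. Qed.

(** The inverse of the volume of a ball decreases with the positive radius and
vanishes elsewhere, hence its superlevel sets are intervals. *)
Let measurable_inv_ball_volume x :
  measurable_fun setT (fun r : R => (fine (m (ball x r)))^-1).
Proof.
apply: (measurability _ (RGenOInfty.measurableE R)).
move=> /= _ [_ [a ->] <-]; rewrite setTI; apply: is_interval_measurable.
move=> r s /=; rewrite !in_itv /= !andbT => ar as_ t /andP[rt ts].
rewrite in_itv /= andbT; have [a0|a0] := ltP a 0.
  by rewrite (lt_le_trans a0)// invr_ge0 fine_ge0// outer_measure_ge0.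
have r0 : 0 < r.
  rewrite ltNge; apply/negP => r0; move: ar.
  have -> : ball x r = set0; last by rewrite outer_measure0 /= invr0 ltNge a0.
  by rewrite -subset0 => z; rewrite ballEmdist /= ltNge (le_trans r0)// mdist_ge0.
apply: (lt_le_trans as_); rewrite lef_pV2 ?posrE ?ball_volume_gt0//.
- exact: le_ball_volume.
- by rewrite (lt_le_trans r0)// (le_trans rt).
- exact: lt_le_trans rt.
Qed.

Lemma measurable_ball_ratio x : measurable_fun setT (ball_ratio x : borel -> R).
Proof.
have mdx : measurable_fun setT (mdist x : borel -> R).
  by apply: continuous_borel; exact: mdist_continuous.
apply: measurable_funM => //.
exact: (measurableT_comp (measurable_inv_ball_volume x)).
Qed.

Let dyadic_le_dist x z rho : 0 < rho -> z != x -> mdist x z < rho ->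
  exists k, rho / (2 ^ k.+1)%:R <= mdist x z < rho / (2 ^ k)%:R.
Proof.
move=> rho0 zx zrho; have d0 : 0 < mdist x z by rewrite mdist_gt0 eq_sym.
have pow0 k : 0 < (2 ^ k)%:R :> R by rewrite ltr0n expn_gt0.
have exk : exists k, rho / (2 ^ k.+1)%:R <= mdist x z.
  have [n rn] : exists n, rho / mdist x z < n%:R.
    by exists (Num.trunc (rho / mdist x z)).+1; exact: truncnS_gt.
  exists n; rewrite ler_pdivrMr// mulrC -ler_pdivrMr// (le_trans (ltW rn))//.
  by rewrite ler_nat (leq_trans (ltnW (ltn_expl n (leqnn 2))))// leq_exp2l.
case: (ex_minnP exk) => k kd kmin; exists k; rewrite kd /=.
case: k kd kmin => [|k] kd kmin; first by rewrite expn0 divr1.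
by rewrite ltNge; apply/negP => /kmin; rewrite ltnn.
Qed.

(** With s = rho / 2 ^ k, the ratio is at most s / m(B_{s/2}) on the annulus
between the radii s/2 and s, and the doubling condition bounds the integral over
the annulus by CD s; these bounds form a geometric series. *)
Lemma integral_ball_ratio x rho : 0 < rho ->
  (\int[mB]_(z in ball x rho) (ball_ratio x z)%:E <= (2 * CD * rho)%:E)%E.
Proof.
move=> rho0; have pow0 k : 0 < (2 ^ k)%:R :> R by rewrite ltr0n expn_gt0.
have mball r : measurable (ball x r : set borel).
  by apply: open_borel; exact: open_mball.
pose a k : R := rho / (2 ^ k)%:R / fine (m (ball x (rho / (2 ^ k.+1)%:R))).
have a0 k : 0 <= a k.
  by rewrite !mulr_ge0 ?invr_ge0 ?fine_ge0 ?outer_measure_ge0// ltW.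
pose f k (z : borel) := ((a k)%:E * (\1_(ball x (rho / (2 ^ k)%:R)) z)%:E)%E.
have f0 k z : (0 <= f k z)%E by rewrite mule_ge0// lee_fin.
have mf k : measurable_fun setT (f k).
  apply: measurable_funeM; apply/measurable_EFinP.
  exact: measurable_indic.
apply: (@le_trans _ _ (\int[mB]_(z in ball x rho) \sum_(0 <= k <oo) f k z)%E).
  apply: ge0_le_integral => //.
  - by move=> z _; rewrite lee_fin ball_ratio_ge0.
  - by apply/measurable_funTS/measurable_EFinP; exact: measurable_ball_ratio.
  - apply: (@ge0_emeasurable_sum _ _ _ _ _ xpredT) => // k _.
    exact: measurable_funTS.
  - move=> z; rewrite ballEmdist /= => xz.
    have [->|zx] := eqVneq z x.
      by rewrite /ball_ratio mdistxx mul0r nneseries_ge0.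
    have [k /andP[kd dk]] := dyadic_le_dist rho0 zx xz.
    apply: le_trans (nneseries_lim_ge k.+1 (fun n _ _ => f0 n z)).
    rewrite big_nat_recr//=; apply: (@le_trans _ _ (f k z)); last first.
      by rewrite leeDr// sume_ge0.
    rewrite /f indicE mem_set ?mule1 ?lee_fin; last by rewrite ballEmdist.
    apply: ler_pM; rewrite ?mdist_ge0 ?invr_ge0 ?fine_ge0 ?outer_measure_ge0//.
      exact: ltW.
    rewrite lef_pV2 ?posrE ?ball_volume_gt0 ?divr_gt0 ?mdist_gt0 1?eq_sym//.
    exact: le_ball_volume.
rewrite integral_nneseries//; last by move=> k; exact: measurable_funTS.
have := @epsilon_trick R (cst 0%E) (2 * CD * rho) xpredT (fun _ => lexx _).
have CDrho : 0 <= 2 * CD * rho by rewrite !mulr_ge0 ?ltW// (lt_le_trans ltr01).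
move=> /(_ CDrho); rewrite [X in (_ <= X + _)%E -> _]eseries0// add0e.
apply: le_trans; apply: lee_nneseries => k _; first by rewrite integral_ge0.
rewrite add0e ge0_integralZl_EFin//; last first.
  by apply/measurable_funTS/measurable_EFinP; exact: measurable_indic.
rewrite integral_indic//.
set r := rho / (2 ^ k.+1)%:R.
have r0 : 0 < r by rewrite divr_gt0.
have r2 : rho / (2 ^ k)%:R = 2 * r.
  by rewrite /r expnS natrM; field; rewrite gt_eqF.
apply: (@le_trans _ _ ((a k)%:E * (CD%:E * m (ball x r)))%E).
  rewrite lee_wpmul2l ?lee_fin// r2; apply: le_trans (mD _ r0).
  rewrite mBE; apply: le_outer_measure; exact: subIsetl.
rewrite -(fineK (ball_measure_fin mms x r)) -!EFinM lee_fin.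
have v0 := ball_volume_gt0 x r0.
rewrite /a -/r r2 -[leRHS]mulrA -/r.
move: (fine _) v0 => v v0; rewrite (_ : _ * (CD * v) = 2 * CD * r)//.
by field; rewrite gt_eqF.
Qed.

Let riesz_density_indic L x y : riesz m L x y = fun z =>
  (ball_ratio x z + ball_ratio y z) *
  \1_(twoballs L x y `\` ([set x] `|` [set y])) z.
Proof.
apply/funext => z.
have in1 a : (z \in [set a]) = (z == a) by apply/idP/eqP; rewrite inE.
rewrite /riesz !indicE in_setD in_setU !in1.
by case: ifP => _; rewrite ?andbT ?andbF ?mulr0.
Qed.

Let twoballs_far L x y rho : (`|L| + 1) * mdist x y < rho ->
  twoballs L x y `<=` ball x rho `&` ball y rho.
Proof.
move=> Lrho z; have LL : L * mdist x y <= `|L| * mdist x y.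
  by rewrite ler_wpM2r ?mdist_ge0// ler_norm.
have := mdist_ge0 x y; have := metric_triangle x y z.
have := metric_triangle y x z; rewrite (metric_sym y x) /twoballs !ballEmdist /=.
by move=> *; split; rewrite ?ballEmdist /=; lra.
Qed.

Let measurable_riesz L x y : measurable_fun setT (riesz m L x y : borel -> R).
Proof.
rewrite riesz_density_indic; apply: measurable_funM.
  by apply: measurable_funD; exact: measurable_ball_ratio.
have closed1 z : closed [set z] by apply: compact_closed;
  [exact: metric_hausdorff|exact: compact_set1].
apply: measurable_indic; apply: measurableD.
  by apply: open_borel; apply: openU; exact: open_mball.
by apply: measurableU; exact: closed_borel.
Qed.

Let riesz_ge0 L x y z : 0 <= riesz m L x y z.
Proof. by rewrite riesz_density_indic mulr_ge0// addr_ge0 ?ball_ratio_ge0. Qed.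

(** The density is dominated by the sum of the two ball ratios, each restricted
to a ball around its own point that contains both balls of the truncation. *)
Let integral_riesz L x y : (\int[mB]_z (riesz m L x y z)%:E < +oo)%E.
Proof.
pose rho := (`|L| + 1) * mdist x y + 1.
have rho0 : 0 < rho by rewrite ltr_wpDl// mulr_ge0 ?mdist_ge0// addr_ge0.
pose g a := ((fun z => (ball_ratio a z)%:E) \_ (ball a rho : set borel)).
have mball a : measurable (ball a rho : set borel).
  by apply: open_borel; exact: open_mball.
have g0 a z : (0 <= g a z)%E.
  by apply: erestrict_ge0 => w _; rewrite lee_fin ball_ratio_ge0.
have mg a : measurable_fun setT (g a).
  apply/(measurable_restrictT _ _).1 => //.
  by apply/measurable_funTS/measurable_EFinP; exact: measurable_ball_ratio.
have intg a : (\int[mB]_z g a z < +oo)%E.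
  by rewrite -integral_mkcond (le_lt_trans (integral_ball_ratio a rho0))// ltry.
apply: (@le_lt_trans _ _ (\int[mB]_z (g x z + g y z))%E); last first.
  by rewrite ge0_integralD// lte_add_pinfty.
apply: ge0_le_integral => //.
- by move=> z _; rewrite lee_fin.
- exact/measurable_EFinP.
- exact: emeasurable_funD.
move=> z _; have [Tz|nTz] := pselect (twoballs L x y z); last first.
  rewrite riesz_density_indic indicE memNset ?mulr0 ?adde_ge0//.
  by case.
have [xz yz] : (ball x rho `&` ball y rho) z.
  by apply: twoballs_far Tz; rewrite /rho ltrDl.
rewrite /g !patchE !mem_set// -EFinD lee_fin riesz_density_indic.
by rewrite ler_piMr ?indic_le1// addr_ge0 ?ball_ratio_ge0.
Qed.

Lemma riesz_outer_extension L x y :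
  exists nu : {finite_measure set borel -> \bar R},
    riesz_measure m L x y = outer_extension nu.
Proof.
have [|||nu nuE] := @finite_density_measure _ borel R mB
    (fun z => (riesz m L x y z)%:E).
- exact/measurable_EFinP.
- by move=> z; rewrite lee_fin.
- exact: integral_riesz.
exists nu; apply/funext => A; rewrite /riesz_measure /outer_extension nuE.
by rewrite /density_measure mBE.
Qed.

End riesz_density.

(** * From the Minkowski content to the Poincare inequality *)

Section minkowski_to_poincare.
Context (R : realType) (X : pmetricType R).
Let borel := g_sigma_algebraType (@open X).
Local Open Scope ereal_scope.

Import HBNNSimple.

Lemma integral_outer_extension (nu : {measure set borel -> \bar R})
    (f : borel -> \bar R) :
  \int[outer_extension nu : set borel -> \bar R]_z f z = \int[nu]_z f z.
Proof.
rewrite /integral; congr (ereal_sup _ - ereal_sup _);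
  apply: eq_imagel => h _; rewrite /sintegral; apply: eq_fsbigr => r _;
  congr (_ * _); apply: outer_extension_borel; exact: measurable_funPTI.
Qed.

(** If u y < u x then the superlevel sets of u at the values in between separate
x from y; if u x < u y the same holds for -u, which has the same lip. *)
Lemma minkowski_poincare (nu : {finite_measure set borel -> \bar R}) x y (c : R) :
  (0 < c)%R ->
  (forall Omega, SS_top x y Omega ->
    c%:E <= minkowski_content (outer_extension nu) Omega) ->
  forall u, Lip u -> `|u x - u y|%:E <= c^-1%:E * \int[nu]_z lip u z.
Proof.
move=> c0 mink.
have ordered u : Lip u -> (u y < u x)%R ->
    (u x - u y)%:E <= c^-1%:E * \int[nu]_z lip u z.
  move=> lipu uyx; rewrite lee_pdivlMl// -EFinM.
  apply: coarea_minkowski => //; first exact: ltW.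
  move=> t /andP[yt tx]; have [K /mlipschitz_continuous cu] := lipu.
  have ot : open [set z | u z < t]%R.
    by apply: open_lt_fun => //; exact: cst_continuous.
  have cot : closed [set z | t <= u z]%R.
    rewrite (_ : [set _ | _] = ~` [set z | u z < t]%R); first exact: open_closedC.
    by apply/seteqP; split => z /=; rewrite leNgt => /negP.
  have -> : minkowski_content nu [set z | t <= u z]%R =
      minkowski_content (outer_extension nu) [set z | t <= u z]%R.
    rewrite /minkowski_content; congr limf_einf; apply/funext => r.
    rewrite outer_extension_borel//; apply: measurableD; last exact: closed_borel.
    by apply: open_borel; apply: bigcup_open => z _; exact: open_mball.
  apply: mink; split => //; last by apply/negP; rewrite -ltNge.
  have : nbhs x [set z | t < u z]%R.
    apply: open_nbhs_nbhs; split => //.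
    by apply: open_lt_fun => //; exact: cst_continuous.
  by apply: filterS => z /= /ltW.
move=> u lipu; have [uyx|uxy|->] := ltgtP (u y) (u x); last 1 first.
- rewrite subrr normr0 mule_ge0//; first by rewrite lee_fin invr_ge0 ltW.
  by apply: integral_ge0 => z _; exact: lip_ge0.
- by rewrite gtr0_norm ?subr_gt0//; exact: ordered.
have lipN : Lip (\- u)%R.
  have [K uK] := lipu; exists K => w z /=.
  by rewrite -opprD normrN; exact: uK.
rewrite distrC gtr0_norm ?subr_gt0//.
have -> : (u y - u x = (\- u) x - (\- u) y)%R by rewrite /= opprK addrC.
have -> : lip u = lip (\- u)%R.
  apply/funext => z; rewrite /lip; case: asboolP => // _.
  suff -> : (fun w => (`|u w - u z| / mdist z w)%:E) =
            (fun w => (`|(\- u) w - (\- u) z| / mdist z w)%:E)%R by [].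
  by apply/funext => w; rewrite /= -opprD normrN.
by apply: ordered => //=; rewrite ltrN2.
Qed.

End minkowski_to_poincare.

(** * The quantitative equivalence *)

Section quantitative_equivalence.
Context (R : realType).

Lemma quant_implies_trans (P Q S : two_constant_property R) :
  quant_implies P Q -> quant_implies Q S -> quant_implies P S.
Proof.
move=> PQ QS CD C L CD1 C0 L1.
have [C1 [L1' [C10 L10 pq]]] := PQ CD C L CD1 C0 L1.
have [C2 [L2' [C20 L20 qs]]] := QS CD C1 L1' CD1 C10 L10.
exists C2, L2'; split => // X m x y mms mD p.
by apply: qs => //; exact: pq.
Qed.

Lemma riesz_measureP (X : pmetricType R) (m : {outer_measure set X -> \bar R})
    CD L x y : is_metric_measure_space m -> 1 <= CD -> doubling CD m ->
  exists nu : {finite_measure set (g_sigma_algebraType (@open X)) -> \bar R},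
    riesz_measure m L x y = outer_extension nu.
Proof.
move=> mms CD1 mD; have [_ _ [mcara _ _ _] _] := mms.
have [mB mBE] := borel_measure mcara.
exact: (riesz_outer_extension mms CD1 mD mBE).
Qed.

Lemma poincare_implies_width :
  quant_implies (@pointwise_poincare R) (@chain_width_bound R).
Proof.
move=> CD C L CD1 C0 L1; exists C, L; split => // X m x y mms mD.
have [nu nuE] := riesz_measureP L x y mms CD1 mD.
rewrite /pointwise_poincare /chain_width_bound nuE => poincare.
apply: poincare_chain_width => // u /poincare.
by rewrite integral_outer_extension.
Qed.

Lemma width_implies_minkowski :
  quant_implies (@chain_width_bound R) (@minkowski_content_bound R).
Proof.
move=> CD C L CD1 C0 L1; exists C^-1, L; split => //; first by rewrite invr_gt0.
by move=> X m x y mms mD width; exact: chain_width_minkowski.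
Qed.

Lemma minkowski_implies_poincare :
  quant_implies (@minkowski_content_bound R) (@pointwise_poincare R).
Proof.
move=> CD C L CD1 C0 L1; exists C^-1, L; split => //; first by rewrite invr_gt0.
move=> X m x y mms mD.
have [nu nuE] := riesz_measureP L x y mms CD1 mD.
rewrite /pointwise_poincare /minkowski_content_bound nuE => mink u lipu.
by rewrite integral_outer_extension; exact: minkowski_poincare.
Qed.

End quantitative_equivalence.

Theorem theorem7p11 (R : realType) :
  [/\ quant_equiv (@pointwise_poincare R) (@chain_width_bound R),
      quant_equiv (@chain_width_bound R) (@minkowski_content_bound R) &
      quant_equiv (@pointwise_poincare R) (@minkowski_content_bound R)].
Proof.
have PW := @poincare_implies_width R; have WM := @width_implies_minkowski R.
have MP := @minkowski_implies_poincare R.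
split; split => //.
- exact: quant_implies_trans WM MP.
- exact: quant_implies_trans MP PW.
- exact: quant_implies_trans PW WM.
Qed.
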